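(* Let $n,m$ be integers with $0\le m<n$, and suppose $\chi_n>c^2$. Let $t_1<\dots<t_n$ be the roots of $\psi_n$ in $(-1,1)$, $\Psi_n(1,t)=\int_0^1\psi_n(x)e^{-icxt}\,dx$, and $$P_{n,m}=\sum_{j=1}^n\frac{\psi_m(t_j)}{\psi_n'(t_j)}\Psi_n(1,t_j).$$ Then $c|P_{n,m}|\le\sqrt{32}\,n^2$.
   Context: For a real number $c>0$, let $F_c[\varphi](x)=\int_{-1}^1\varphi(t)e^{icxt}\,dt$ on $L^2[-1,1]$, with eigenvalues $\lambda_0,\lambda_1,\dots$ ordered so that $|\lambda_n|\ge|\lambda_{n+1}|$ and corresponding real eigenfunctions $\psi_0,\psi_1,\dots$ (prolate spheroidal wave functions) with $\|\psi_n\|_{L^2[-1,1]}=1$; $\psi_n$ has the parity of $n$ and exactly $n$ simple roots in $(-1,1)$. $\chi_0<\chi_1<\dots$ are the positive numbers such that $\psi_n$ satisfies $(1-x^2)\psi''(x)-2x\psi'(x)+(\chi_n-c^2x^2)\psi(x)=0$. *)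

(* Defs.v *)
From Stdlib Require Import Reals.
From Coquelicot Require Import Coquelicot.
Open Scope R_scope.

(* Real and imaginary parts of F_c[phi](x) = int_{-1}^1 phi(t) e^{i c x t} dt,
   for real-valued phi. *)
Definition Fc_re (c : R) (phi : R -> R) (x : R) : R :=
  RInt (fun t => phi t * cos (c * x * t)) (-1) 1.
Definition Fc_im (c : R) (phi : R -> R) (x : R) : R :=
  RInt (fun t => phi t * sin (c * x * t)) (-1) 1.

(* The defining properties (from the standing context) of the prolate
   spheroidal wave functions psi_n with bandwidth c, eigenvalues
   lambda_n = lam_re n + i lam_im n of F_c, and ODE eigenvalues chi_n. *)
Record PSWF_system (c : R) (lam_re lam_im : nat -> R)
    (psi : nat -> R -> R) (chi : nat -> R) : Prop := {
  pswf_cont : forall n x, -1 <= x <= 1 -> continuous (psi n) x;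
  pswf_norm : forall n, RInt (fun x => psi n x ^ 2) (-1) 1 = 1;
  pswf_eig : forall n x, -1 <= x <= 1 ->
    Fc_re c (psi n) x = lam_re n * psi n x /\
    Fc_im c (psi n) x = lam_im n * psi n x;
  pswf_order : forall n,
    lam_re (S n) ^ 2 + lam_im (S n) ^ 2 <= lam_re n ^ 2 + lam_im n ^ 2;
  pswf_parity : forall n x, psi n (- x) = (-1) ^ n * psi n x;
  pswf_roots : forall n, exists r : nat -> R,
    (forall j, (1 <= j < n)%nat -> r j < r (S j)) /\
    (forall j, (1 <= j <= n)%nat -> -1 < r j < 1 /\ psi n (r j) = 0) /\
    (forall x, -1 < x < 1 -> psi n x = 0 ->
       exists j, (1 <= j <= n)%nat /\ x = r j);
  pswf_simple : forall n x, -1 < x < 1 -> psi n x = 0 ->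
    Derive (psi n) x <> 0;
  pswf_ode : forall n x, -1 < x < 1 ->
    ex_derive (psi n) x /\ ex_derive (Derive (psi n)) x /\
    (1 - x ^ 2) * Derive (Derive (psi n)) x - 2 * x * Derive (psi n) x
      + (chi n - c ^ 2 * x ^ 2) * psi n x = 0;
  pswf_chi_pos : forall n, 0 < chi n;
  pswf_chi_incr : forall n, chi n < chi (S n)
}.

(* Psi_n(1,t) = int_0^1 psi_n(x) e^{-i c x t} dx, real and imaginary parts. *)
Definition Psi1_re (c : R) (phi : R -> R) (t : R) : R :=
  RInt (fun x => phi x * cos (c * x * t)) 0 1.
Definition Psi1_im (c : R) (phi : R -> R) (t : R) : R :=
  - RInt (fun x => phi x * sin (c * x * t)) 0 1.

Definition P_re (c : R) (psi : nat -> R -> R) (n m : nat) (t : nat -> R) : R :=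
  sum_n_m (fun j => psi m (t j) / Derive (psi n) (t j) * Psi1_re c (psi n) (t j)) 1 n.
Definition P_im (c : R) (psi : nat -> R -> R) (n m : nat) (t : nat -> R) : R :=
  sum_n_m (fun j => psi m (t j) / Derive (psi n) (t j) * Psi1_im c (psi n) (t j)) 1 n.

(* Main.v *)
Require Import Defs.
From Stdlib Require Import Reals Lra Lia Psatz Classical_Prop.
From Coquelicot Require Import Coquelicot.
Open Scope R_scope.

(** Write [p = 1 - x^2], [q = chi - c^2 x^2], [f = psi_n].  When [chi > c^2],
    on [[0, 1)] the quantity [f^2 + (p / q) f'^2] is nondecreasing and
    [E = p q f^2 + (p f')^2] is nonincreasing.  At a root [t] the former gives
    [f'(t)^2 >= E 0] and the latter [p^2 f'(t)^2 >= const * f(1)^2], while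
    [int f^2 = 1] forces [f(1)^2 E 0 >= chi / 9]; multiplying,
    [p(t) f'(t)^2 >= const * sqrt chi_n].  On the other side, integrating
    [(p psi_m^2)'] gives [p psi_m^2 <= 1 + sqrt chi_m], so the weight [p] cancels
    in [psi_m(t)^2 / f'(t)^2].  Since a Sturm comparison gives
    [c <= pi (n + 1) / 2], this ratio is at most [(8 n / c)^2], and
    [|Psi_n(1, t)| <= 1 / sqrt 2] by Cauchy-Schwarz. *)

(** * The prolate equation near the singular endpoint *)

(** One [psi_n] in isolation. Continuity up to the endpoints excludes the solutions with a
    logarithmic singularity there, and the sign [s] stands for [(-1) ^ n]. *)
Record prolate (c chi : R) (f : R -> R) : Prop := {
  prolate_cont : forall x, -1 <= x <= 1 -> continuous f x;
  prolate_ode : forall x, -1 < x < 1 ->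
    ex_derive f x /\ ex_derive (Derive f) x /\
    (1 - x ^ 2) * Derive (Derive f) x - 2 * x * Derive f x
      + (chi - c ^ 2 * x ^ 2) * f x = 0;
  prolate_parity : exists s, s ^ 2 = 1 /\ forall x, f (- x) = s * f x
}.

(** In self-adjoint form the equation reads [(flux f)' = - (chi - c ^ 2 * x ^ 2) * f]. *)
Definition flux (f : R -> R) (x : R) : R := (1 - x ^ 2) * Derive f x.

Lemma nondecreasing_of_derive (g dg : R -> R) (a b : R) :
  a <= b ->
  (forall x, a <= x <= b -> is_derive g x (dg x)) ->
  (forall x, a <= x <= b -> 0 <= dg x) ->
  g a <= g b.
Proof.
  intros Hab Hd Hpos.
  destruct (MVT_gen g a b dg) as [xi [Hxi E]].
  - rewrite Rmin_left, Rmax_right by lra. intros x Hx. apply Hd; lra.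
  - rewrite Rmin_left, Rmax_right by lra. intros x Hx.
    apply continuity_pt_filterlim, (ex_derive_continuous g x).
    exists (dg x). apply Hd; lra.
  - rewrite Rmin_left, Rmax_right in Hxi by lra.
    specialize (Hpos xi Hxi). nra.
Qed.

(** Needed chiefly at the endpoint 1, where the equation gives no information on [Derive f]. *)
Lemma le_of_le_near_left (g : R -> R) (a b K : R) :
  a < b -> continuous g b -> (forall x, a < x < b -> K <= g x) -> K <= g b.
Proof.
  intros Hab Hg Hle. apply Rnot_lt_le; intros Hlt.
  assert (He : 0 < K - g b) by lra.
  destruct (Hg _ (locally_ball (g b) (mkposreal _ He))) as [d Hd].
  set (x := Rmax ((a + b) / 2) (b - d / 2)).
  assert (Hx : a < x < b).
  { unfold x. split.
    - apply Rlt_le_trans with ((a + b) / 2); [lra | apply Rmax_l].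
    - apply Rmax_lub_lt; [lra | destruct d; simpl; lra]. }
  assert (Hb : ball (g b) (K - g b) (g x)).
  { apply Hd. change (Rabs (x - b) < d). rewrite Rabs_left by lra.
    assert (b - d / 2 <= x) by apply Rmax_r. destruct d; simpl in *; lra. }
  change (Rabs (g x - g b) < K - g b) in Hb.
  apply Rabs_def2 in Hb. specialize (Hle x Hx). lra.
Qed.

Lemma prolate_opp (c chi : R) (f : R -> R) :
  prolate c chi f -> prolate c chi (fun x => - f x).
Proof.
  intros Hf; constructor.
  - intros x Hx. apply (continuous_opp f), (prolate_cont _ _ _ Hf x Hx).
  - intros x Hx. destruct (prolate_ode _ _ _ Hf x Hx) as [H1 [H2 H3]].
    assert (E : forall y, Derive (fun x => - f x) y = - Derive f y)
      by (intros; apply Derive_opp).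
    repeat split.
    + now apply (ex_derive_opp f).
    + apply ex_derive_ext with (fun y => - Derive f y); [now intros; rewrite E|].
      now apply (ex_derive_opp (Derive f)).
    + rewrite (Derive_ext _ _ x E), E, Derive_opp. lra.
  - destruct (prolate_parity _ _ _ Hf) as [s [Hs H]]. exists s; split; [easy|].
    intros x; rewrite H; ring.
Qed.

Lemma flux_opp (f : R -> R) (x : R) : flux (fun y => - f y) x = - flux f x.
Proof. unfold flux. rewrite Derive_opp. ring. Qed.

Lemma prolate_Derive2 (c chi : R) (f : R -> R) (x : R) :
  prolate c chi f -> -1 < x < 1 ->
  Derive (Derive f) x =
    (2 * x * Derive f x - (chi - c ^ 2 * x ^ 2) * f x) / (1 - x ^ 2).
Proof.
  intros Hf Hx. destruct (prolate_ode _ _ _ Hf x Hx) as [_ [_ H]].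
  assert (1 - x ^ 2 <> 0) by nra.
  apply Rmult_eq_reg_r with (1 - x ^ 2); [|assumption].
  unfold Rdiv. rewrite Rmult_assoc, Rinv_l by assumption. lra.
Qed.

(** Differentiation at an interior point, followed by elimination of the second derivative through
    the equation; an identity in [f] and [Derive f] remains. *)
Ltac prolate_derive Hf Hx :=
  let H1 := fresh in let H2 := fresh in
  destruct (prolate_ode _ _ _ Hf _ Hx) as [H1 [H2 _]];
  match type of Hf with prolate _ _ ?f =>
    auto_derive;
    [ repeat split; auto
    | change (fun z : R => Derive f z) with (Derive f);
      change (fun z : R => f z) with f;
      rewrite ?(prolate_Derive2 _ _ _ _ Hf Hx) ]
  end.

Lemma is_derive_flux (c chi : R) (f : R -> R) (x : R) :
  prolate c chi f -> -1 < x < 1 ->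
  is_derive (flux f) x (- ((chi - c ^ 2 * x ^ 2) * f x)).
Proof.
  intros Hf Hx. unfold flux. assert (1 - x ^ 2 <> 0) by nra.
  prolate_derive Hf Hx. field. nra.
Qed.

(* If the flux did not vanish at [1], [f] would grow like [ln (1 - x)]. *)
Lemma flux_upper_bound (c chi : R) (f : R -> R) (x B : R) :
  prolate c chi f -> 0 <= x < 1 ->
  (forall y, x <= y < 1 -> Rabs ((chi - c ^ 2 * y ^ 2) * f y) <= B) ->
  flux f x <= B * (1 - x).
Proof.
  intros Hf Hx HB. apply Rnot_lt_le; intros Hlt.
  set (e := flux f x - B * (1 - x)).
  assert (He : 0 < e) by (unfold e; lra).
  (* [flux f y + B * y] is nondecreasing, so the excess [e] persists up to 1. *)
  assert (Hflux : forall y, x <= y < 1 -> e <= flux f y).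
  { intros y Hy.
    assert (flux f x + B * x <= flux f y + B * y).
    { apply (nondecreasing_of_derive (fun z => flux f z + B * z)
        (fun z => - ((chi - c ^ 2 * z ^ 2) * f z) + B)); [lra| |].
      - intros z Hz. apply (is_derive_plus (flux f) (fun z => B * z)).
        + apply is_derive_flux; [assumption | lra].
        + auto_derive; [easy | ring].
      - intros z Hz. assert (H := HB z ltac:(lra)).
        apply Rabs_le_between in H. lra. }
    assert (0 <= B).
    { apply Rle_trans with (2 := HB x ltac:(lra)). apply Rabs_pos. }
    unfold e. nra. }
  (* Since [1 - z ^ 2 <= 2 * (1 - z)], a flux of at least [e] gives
     [Derive f z >= e / (2 * (1 - z))], the derivative of [- e / 2 * ln (1 - z)]. *)
  assert (Hgrow : forall y, x <= y < 1 ->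
    f x + e / 2 * ln (1 - x) <= f y + e / 2 * ln (1 - y)).
  { intros y Hy.
    apply (nondecreasing_of_derive (fun z => f z + e / 2 * ln (1 - z))
      (fun z => Derive f z - e / 2 * / (1 - z))); [lra| |].
    - intros z Hz.
      destruct (prolate_ode _ _ _ Hf z ltac:(lra)) as [H1 _].
      auto_derive; [repeat split; auto; lra | change (fun z : R => f z) with f; field; lra].
    - intros z Hz. specialize (Hflux z ltac:(lra)). unfold flux in Hflux.
      assert (HD : 0 < Derive f z).
      { apply Rmult_lt_reg_l with (1 - z ^ 2); [nra | lra]. }
      apply Rmult_le_reg_l with (2 * (1 - z)); [lra|].
      replace (2 * (1 - z) * (Derive f z - e / 2 * / (1 - z)))
        with (2 * (1 - z) * Derive f z - e) by (field; lra).
      assert (0 <= (1 - z) ^ 2 * Derive f z) by (apply Rmult_le_pos; nra).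
      nra. }
  assert (Hnear : exists d, 0 < d /\ forall y, 1 - d < y < 1 -> f y < f 1 + 1).
  { destruct (prolate_cont _ _ _ Hf 1 ltac:(lra)
      _ (locally_ball (f 1) (mkposreal 1 Rlt_0_1))) as [d Hd].
    exists d; split; [apply cond_pos|]. intros y Hy.
    assert (H : ball (f 1) 1 (f y)).
    { apply Hd. change (Rabs (y - 1) < d). rewrite Rabs_left; lra. }
    change (Rabs (f y - f 1) < 1) in H. apply Rabs_def2 in H. lra. }
  destruct Hnear as [d [Hd Hbd]].
  (* [L] is the value of [ln (1 - y)] at which [Hgrow] forces [f y] up to [f 1 + 1]; [y] is so close
     to 1 that [ln (1 - y) <= L], against [Hbd]. *)
  set (L := ln (1 - x) - 2 * (f 1 + 1 - f x) / e).
  set (y := 1 - Rmin (d / 2) (Rmin (1 - x) (exp L))).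
  assert (Hm : 0 < Rmin (d / 2) (Rmin (1 - x) (exp L))).
  { repeat apply Rmin_glb_lt; try lra. apply exp_pos. }
  assert (Hm1 := Rmin_l (d / 2) (Rmin (1 - x) (exp L))).
  assert (Hm2 := Rmin_r (d / 2) (Rmin (1 - x) (exp L))).
  assert (Hm3 := Rmin_l (1 - x) (exp L)).
  assert (Hm4 := Rmin_r (1 - x) (exp L)).
  assert (Hy : x <= y < 1) by (unfold y; lra).
  assert (H1 := Hgrow y Hy).
  assert (H2 := Hbd y ltac:(unfold y; lra)).
  assert (Hln : ln (1 - y) <= L).
  { rewrite <- (ln_exp L). apply ln_le; unfold y; lra. }
  assert (e / 2 * ln (1 - y) <= e / 2 * L) by (apply Rmult_le_compat_l; lra).
  assert (E : e / 2 * L = e / 2 * ln (1 - x) - (f 1 + 1 - f x))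
    by (unfold L; field; lra).
  lra.
Qed.

(** The equation integrated over [[x, 1]], with vanishing boundary term at 1; the other sign comes
    from [- f]. *)
Lemma flux_bound (c chi : R) (f : R -> R) (x B : R) :
  prolate c chi f -> 0 <= x < 1 ->
  (forall y, x <= y < 1 -> Rabs ((chi - c ^ 2 * y ^ 2) * f y) <= B) ->
  Rabs (flux f x) <= B * (1 - x).
Proof.
  intros Hf Hx HB. apply Rabs_le_between. split.
  - assert (H := flux_upper_bound c chi (fun y => - f y) x B (prolate_opp _ _ _ Hf) Hx).
    rewrite flux_opp in H.
    enough (- flux f x <= B * (1 - x)) by lra. apply H.
    intros y Hy. rewrite <- Ropp_mult_distr_r, Rabs_Ropp. now apply HB.
  - now apply flux_upper_bound with c chi.
Qed.

Lemma prolate_bounded (c chi : R) (f : R -> R) :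
  prolate c chi f -> exists B, forall x, 0 <= x <= 1 -> Rabs (f x) <= B.
Proof.
  intros Hf.
  destruct (continuity_ab_maj (fun x => Rabs (f x)) 0 1) as [z [Hz _]]; [lra| |].
  - intros x Hx. apply continuity_pt_filterlim.
    apply (continuous_comp f Rabs); [|apply continuous_Rabs].
    apply (prolate_cont _ _ _ Hf); lra.
  - exists (Rabs (f z)). exact Hz.
Qed.

(** The factor [1 - x] in [flux_bound] cancels the degenerate factor of [1 - x ^ 2]. *)
Lemma prolate_Derive_bounded (c chi : R) (f : R -> R) :
  prolate c chi f -> exists C, forall x, 0 <= x < 1 -> Rabs (Derive f x) <= C.
Proof.
  intros Hf. destruct (prolate_bounded _ _ _ Hf) as [B HB].
  exists ((Rabs chi + c ^ 2) * B). intros x Hx.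
  assert (H : Rabs (flux f x) <= (Rabs chi + c ^ 2) * B * (1 - x)).
  { apply flux_bound with c chi; [assumption..|]. intros y Hy. rewrite Rabs_mult.
    apply Rmult_le_compat; try apply Rabs_pos; [|apply HB; lra].
    apply Rle_trans with (1 := Rabs_triang _ _). rewrite Rabs_Ropp.
    rewrite (Rabs_pos_eq (c ^ 2 * y ^ 2)) by nra.
    assert (0 <= c ^ 2) by nra. assert (y ^ 2 <= 1) by nra. nra. }
  unfold flux in H. rewrite Rabs_mult, (Rabs_pos_eq (1 - x ^ 2)) in H by nra.
  apply Rmult_le_reg_l with (1 - x); [lra|].
  apply Rle_trans with ((1 - x ^ 2) * Rabs (Derive f x)); [|lra].
  apply Rmult_le_compat_r; [apply Rabs_pos | nra].
Qed.

(** * Monotone quantities when [c ^ 2 < chi] *)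

Definition amplitude (c chi : R) (f : R -> R) (x : R) : R :=
  f x ^ 2 + (1 - x ^ 2) / (chi - c ^ 2 * x ^ 2) * Derive f x ^ 2.

Definition energy (c chi : R) (f : R -> R) (x : R) : R :=
  (1 - x ^ 2) * (chi - c ^ 2 * x ^ 2) * f x ^ 2 + flux f x ^ 2.

Lemma potential_pos (c chi x : R) :
  c ^ 2 < chi -> -1 <= x <= 1 -> 0 < chi - c ^ 2 * x ^ 2.
Proof. intros Hc Hx. assert (0 <= c ^ 2) by nra. assert (x ^ 2 <= 1) by nra. nra. Qed.

Lemma potential_ge (c chi x : R) :
  c ^ 2 < chi -> chi * (1 - x ^ 2) <= chi - c ^ 2 * x ^ 2.
Proof. intros Hc. assert (0 <= x ^ 2) by nra. nra. Qed.

(** By the equation the terms in [f * Derive f] cancel, leaving a nonnegative multiple of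
    [Derive f ^ 2]. *)
Lemma amplitude_nondecreasing (c chi : R) (f : R -> R) (x y : R) :
  prolate c chi f -> c ^ 2 < chi -> 0 <= x -> x <= y -> y < 1 ->
  amplitude c chi f x <= amplitude c chi f y.
Proof.
  intros Hf Hc Hx Hxy Hy. unfold amplitude.
  apply (nondecreasing_of_derive (amplitude c chi f)
    (fun z => 2 * z * ((chi - c ^ 2 * z ^ 2) + c ^ 2 * (1 - z ^ 2))
       / (chi - c ^ 2 * z ^ 2) ^ 2 * Derive f z ^ 2)); [assumption| |].
  - intros z Hz. assert (Hz' : -1 < z < 1) by lra.
    assert (Hq := potential_pos c chi z Hc ltac:(lra)).
    unfold amplitude. prolate_derive Hf Hz'; [simpl in Hq; nra|].
    field. split; simpl in *; nra.
  - intros z Hz. assert (Hq := potential_pos c chi z Hc ltac:(lra)).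
    apply Rmult_le_pos; [|apply pow2_ge_0].
    apply Rle_mult_inv_pos; [|nra].
    apply Rmult_le_pos; [lra|].
    assert (0 <= c ^ 2 * (1 - z ^ 2)) by (apply Rmult_le_pos; nra). lra.
Qed.

(** The cross terms cancel again; what remains is [f ^ 2] times the derivative of
    [(1 - x ^ 2) * (chi - c ^ 2 * x ^ 2)], a product that decreases on [[0, 1)]. *)
Lemma energy_nonincreasing (c chi : R) (f : R -> R) (x y : R) :
  prolate c chi f -> c ^ 2 < chi -> 0 <= x -> x <= y -> y < 1 ->
  energy c chi f y <= energy c chi f x.
Proof.
  intros Hf Hc Hx Hxy Hy. apply Ropp_le_cancel.
  apply (nondecreasing_of_derive (fun z => - energy c chi f z)
    (fun z => 2 * z * ((chi - c ^ 2 * z ^ 2) + c ^ 2 * (1 - z ^ 2)) * f z ^ 2));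
    [assumption| |].
  - intros z Hz. assert (Hz' : -1 < z < 1) by lra.
    unfold energy, flux. prolate_derive Hf Hz'. field. nra.
  - intros z Hz. assert (Hq := potential_pos c chi z Hc ltac:(lra)).
    apply Rmult_le_pos; [|apply pow2_ge_0].
    apply Rmult_le_pos; [lra|].
    assert (0 <= c ^ 2 * (1 - z ^ 2)) by (apply Rmult_le_pos; nra). lra.
Qed.

(** * Control by the value at the endpoint *)

Lemma prolate_sqr_continuous (c chi : R) (f : R -> R) (x : R) :
  prolate c chi f -> -1 <= x <= 1 -> continuous (fun y => f y ^ 2) x.
Proof.
  intros Hf Hx. apply (continuous_comp f (fun u => u ^ 2)).
  - now apply (prolate_cont _ _ _ Hf).
  - apply (ex_derive_continuous (fun u => u ^ 2)). auto_derive; easy.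
Qed.

Lemma prolate_sqr_integrable (c chi : R) (f : R -> R) (a b : R) :
  prolate c chi f -> -1 <= a <= b -> b <= 1 -> ex_RInt (fun y => f y ^ 2) a b.
Proof.
  intros Hf Ha Hb. apply (ex_RInt_continuous (fun y => f y ^ 2)). intros z Hz.
  rewrite Rmin_left, Rmax_right in Hz by lra.
  apply prolate_sqr_continuous with c chi; [assumption | lra].
Qed.

(** [f ^ 2] is at most the amplitude, which increases to [f 1 ^ 2] at 1 because [Derive f] stays
    bounded. In the proof [g] is a majorant of the amplitude that is continuous at 1. *)
Lemma prolate_le_endpoint (c chi : R) (f : R -> R) (x : R) :
  prolate c chi f -> c ^ 2 < chi -> 0 <= x <= 1 -> f x ^ 2 <= f 1 ^ 2.
Proof.
  intros Hf Hc Hx. destruct (Req_dec x 1) as [->|Hx1]; [lra|].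
  destruct (prolate_Derive_bounded _ _ _ Hf) as [C HC].
  set (g := fun y => f y ^ 2 + (1 - y ^ 2) / (chi - c ^ 2 * y ^ 2) * C ^ 2).
  replace (f 1 ^ 2) with (g 1) by (unfold g; field; lra).
  apply le_of_le_near_left with x; [lra| |].
  - unfold g. apply (continuous_plus (fun y => f y ^ 2)).
    + apply prolate_sqr_continuous with c chi; [assumption | lra].
    + apply (ex_derive_continuous (fun y => (1 - y ^ 2) / (chi - c ^ 2 * y ^ 2) * C ^ 2)).
      auto_derive. simpl in Hc; nra.
  - intros y Hy. apply Rle_trans with (amplitude c chi f x).
    + unfold amplitude.
      assert (Hq := potential_pos c chi x Hc ltac:(lra)).
      assert (0 <= (1 - x ^ 2) / (chi - c ^ 2 * x ^ 2))
        by (apply Rle_mult_inv_pos; nra).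
      assert (0 <= Derive f x ^ 2) by apply pow2_ge_0. nra.
    + apply Rle_trans with (amplitude c chi f y).
      * apply amplitude_nondecreasing; lra || assumption.
      * unfold amplitude, g. apply Rplus_le_compat_l, Rmult_le_compat_l.
        -- apply Rle_mult_inv_pos; [nra|]. apply potential_pos; lra.
        -- apply pow_maj_Rabs, HC; lra.
Qed.

(** With [|f| <= |f 1|], [flux_bound] bounds [Derive f] on [[x, 1)] by a constant, and the mean
    value theorem integrates it. This measures how far from 1 a root must lie. *)
Lemma prolate_endpoint_deviation (c chi : R) (f : R -> R) (x : R) :
  prolate c chi f -> c ^ 2 < chi -> 0 <= x < 1 ->
  Rabs (f 1 - f x) <= Rabs (f 1) * ((chi - c ^ 2 * x ^ 2) * (1 - x) / (1 + x)).
Proof.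
  intros Hf Hc Hx.
  assert (Hqx := potential_pos c chi x Hc ltac:(lra)).
  assert (HM := Rabs_pos (f 1)).
  assert (Hder : forall y, x <= y < 1 ->
    Rabs (Derive f y) <= (chi - c ^ 2 * x ^ 2) * Rabs (f 1) / (1 + x)).
  { intros y Hy.
    assert (Hqy := potential_pos c chi y Hc ltac:(lra)).
    assert (Hqxy : chi - c ^ 2 * y ^ 2 <= chi - c ^ 2 * x ^ 2).
    { assert (0 <= c ^ 2) by nra. assert (x ^ 2 <= y ^ 2) by nra. nra. }
    assert (H : Rabs (flux f y) <= (chi - c ^ 2 * x ^ 2) * Rabs (f 1) * (1 - y)).
    { apply flux_bound with c chi; [assumption | lra |]. intros z Hz.
      assert (Hqz := potential_pos c chi z Hc ltac:(lra)).
      rewrite Rabs_mult, (Rabs_pos_eq (chi - _)) by lra.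
      apply Rmult_le_compat; [lra | apply Rabs_pos | |].
      - assert (0 <= c ^ 2) by nra. assert (x ^ 2 <= z ^ 2) by nra. nra.
      - apply Rsqr_le_abs_0. rewrite !Rsqr_pow2.
        apply prolate_le_endpoint with c chi; [assumption.. | lra]. }
    unfold flux in H. rewrite Rabs_mult, (Rabs_pos_eq (1 - y ^ 2)) in H by nra.
    assert (HD := Rabs_pos (Derive f y)).
    apply Rmult_le_reg_r with (1 + x); [lra|].
    unfold Rdiv. rewrite (Rmult_assoc _ (/ _)), Rinv_l, Rmult_1_r by lra.
    apply Rmult_le_reg_l with (1 - y); [lra|].
    apply Rle_trans with ((1 - y ^ 2) * Rabs (Derive f y)); [|lra].
    replace ((1 - y) * (Rabs (Derive f y) * (1 + x)))
      with ((1 - y) * (1 + x) * Rabs (Derive f y)) by ring.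
    apply Rmult_le_compat_r; [assumption | nra]. }
  set (K := (chi - c ^ 2 * x ^ 2) * Rabs (f 1) / (1 + x)) in *.
  replace (Rabs (f 1) * ((chi - c ^ 2 * x ^ 2) * (1 - x) / (1 + x)))
    with (K * (1 - x)) by (unfold K; field; lra).
  apply Rge_le, Rminus_ge, Rle_ge.
  apply (le_of_le_near_left (fun y => K * (1 - x) - Rabs (f y - f x)) x 1 0);
    [lra| |].
  - apply (continuous_minus (fun _ => K * (1 - x)) (fun y => Rabs (f y - f x)));
      [apply continuous_const|].
    apply (continuous_comp (fun y => f y - f x) Rabs); [|apply continuous_Rabs].
    apply (continuous_minus f (fun _ => f x)); [|apply continuous_const].
    apply (prolate_cont _ _ _ Hf); lra.
  - intros y Hy.
    destruct (MVT_gen f x y (Derive f)) as [xi [Hxi E]];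
      rewrite ?Rmin_left, ?Rmax_right in * by lra.
    + intros z Hz. apply Derive_correct. apply (prolate_ode _ _ _ Hf); lra.
    + intros z Hz. apply continuity_pt_filterlim, (prolate_cont _ _ _ Hf); lra.
    + rewrite E, Rabs_mult, (Rabs_pos_eq (y - x)) by lra.
      assert (Rabs (Derive f xi) <= K) by (apply Hder; lra).
      assert (0 <= Rabs (Derive f xi)) by apply Rabs_pos.
      nra.
Qed.

(** With [B = energy 0 / chi], energy monotonicity gives [(1 - x ^ 2) ^ 2 * f x ^ 2 <= B] on
    [[0, Y]]. The extra factor [1 + x ^ 2] makes the majorant the exact derivative of
    [B * (x / (1 - x ^ 2))]. On [[Y, 1]] the endpoint value dominates. *)
Lemma prolate_mass_le (c chi : R) (f : R -> R) (Y : R) :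
  prolate c chi f -> 0 < chi -> c ^ 2 < chi -> 0 <= Y < 1 ->
  RInt (fun x => f x ^ 2) 0 1
    <= energy c chi f 0 / chi * (Y / (1 - Y ^ 2)) + f 1 ^ 2 * (1 - Y).
Proof.
  intros Hf Hchi Hc HY.
  set (B := energy c chi f 0 / chi).
  assert (Hi0 := prolate_sqr_integrable _ _ _ 0 Y Hf ltac:(lra) ltac:(lra)).
  assert (Hi1 := prolate_sqr_integrable _ _ _ Y 1 Hf ltac:(lra) ltac:(lra)).
  rewrite <- (RInt_Chasles _ 0 Y 1 Hi0 Hi1). apply Rplus_le_compat.
  - assert (Hint : is_RInt (fun x => B * ((1 + x ^ 2) / (1 - x ^ 2) ^ 2)) 0 Y
      (B * (Y / (1 - Y ^ 2)))).
    { replace (B * (Y / (1 - Y ^ 2)))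
        with (minus (B * (Y / (1 - Y ^ 2))) (B * (0 / (1 - 0 ^ 2))))
        by (unfold minus, plus, opp; simpl; field; nra).
      apply (is_RInt_derive (fun x => B * (x / (1 - x ^ 2)))
        (fun x => B * ((1 + x ^ 2) / (1 - x ^ 2) ^ 2)));
        intros z Hz; rewrite Rmin_left, Rmax_right in Hz by lra.
      - auto_derive; [nra | field; nra].
      - apply (ex_derive_continuous (fun x => B * ((1 + x ^ 2) / (1 - x ^ 2) ^ 2))).
        auto_derive. assert (1 - z * z > 0) by nra. nra. }
    rewrite <- (is_RInt_unique _ _ _ _ Hint).
    apply RInt_le; [lra | assumption | now eexists; apply Hint |].
    intros z Hz.
    assert (Hen := energy_nonincreasing c chi f 0 z Hf Hc ltac:(lra) ltac:(lra) ltac:(lra)).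
    assert (HB : energy c chi f 0 = chi * B) by (unfold B; field; lra).
    assert (Hq := potential_ge c chi z Hc).
    assert (Hp : 0 < 1 - z ^ 2) by nra.
    assert (Hf2 := pow2_ge_0 (f z)). assert (Hfl := pow2_ge_0 (flux f z)).
    assert (H : (1 - z ^ 2) ^ 2 * f z ^ 2 <= B).
    { apply Rmult_le_reg_l with chi; [lra|]. rewrite <- HB.
      apply Rle_trans with (2 := Hen). unfold energy.
      assert (0 <= (1 - z ^ 2) * f z ^ 2) by (apply Rmult_le_pos; lra).
      nra. }
    assert (HB0 : 0 <= B) by (apply Rle_trans with (2 := H), Rmult_le_pos; nra).
    apply Rmult_le_reg_l with ((1 - z ^ 2) ^ 2); [nra|].
    replace ((1 - z ^ 2) ^ 2 * (B * ((1 + z ^ 2) / (1 - z ^ 2) ^ 2)))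
      with (B + B * z ^ 2) by (field; lra).
    nra.
  - rewrite <- (Rmult_comm (1 - Y)).
    rewrite <- (RInt_const Y 1 (f 1 ^ 2) : _ = (1 - Y) * f 1 ^ 2).
    apply RInt_le; [lra | assumption | apply ex_RInt_const |].
    intros z Hz. apply prolate_le_endpoint with c chi; [assumption.. | lra].
Qed.

(* Optimising [prolate_mass_le] over [Y]: with [b = sqrt B / |f 1|] and
   [1 - Y ^ 2 = b], the bound reads [|f 1| sqrt B (Y + 1 / (1 + Y))]. *)
Lemma prolate_energy_endpoint (c chi : R) (f : R -> R) :
  prolate c chi f -> 0 < chi -> c ^ 2 < chi ->
  RInt (fun x => f x ^ 2) 0 1 = 1 / 2 ->
  1 / 2 <= f 1 ^ 2 /\ chi <= 9 * f 1 ^ 2 * energy c chi f 0.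
Proof.
  intros Hf Hchi Hc Hn.
  assert (Hmass := fun Y => prolate_mass_le c chi f Y Hf Hchi Hc).
  rewrite Hn in Hmass.
  set (B := energy c chi f 0 / chi) in *.
  assert (HM : 1 / 2 <= f 1 ^ 2).
  { specialize (Hmass 0 ltac:(lra)).
    replace (0 / (1 - 0 ^ 2)) with 0 in Hmass by field. lra. }
  split; [assumption|].
  assert (HB : energy c chi f 0 = chi * B) by (unfold B; field; lra).
  assert (HB0 : 0 <= B).
  { unfold B. apply Rle_mult_inv_pos; [|assumption]. unfold energy.
    assert (0 <= f 0 ^ 2) by apply pow2_ge_0.
    assert (0 <= flux f 0 ^ 2) by apply pow2_ge_0. nra. }
  set (M2 := f 1 ^ 2) in *.
  rewrite HB. enough (1 <= 9 * M2 * B) by nra.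
  destruct (Rle_lt_dec M2 B) as [Hle|Hlt]; [nra|].
  set (b := sqrt (B / M2)).
  assert (Hb2 : b ^ 2 = B / M2).
  { unfold b. rewrite pow2_sqrt; [reflexivity|]. apply Rle_mult_inv_pos; lra. }
  assert (Hb2' : B = M2 * b ^ 2) by (rewrite Hb2; field; lra).
  assert (Hb0 : 0 <= b) by apply sqrt_pos.
  assert (Hb1 : b < 1) by (apply Rnot_le_lt; intros ?; assert (1 <= b ^ 2) by nra; nra).
  set (Y := sqrt (1 - b)).
  assert (HY2 : Y ^ 2 = 1 - b) by (unfold Y; rewrite pow2_sqrt; lra).
  assert (HY0 : 0 <= Y) by apply sqrt_pos.
  (* For [b = 0] the choice [1 - Y ^ 2 = b] would give the excluded [Y = 1]; instead
     [Y = 1 - 1 / (4 * M2)] bounds the mass by 1/4, less than 1/2. *)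
  destruct (Req_dec b 0) as [Hbz|Hbz].
  { rewrite Hbz in Hb2'. assert (HBz : B = 0) by (rewrite Hb2'; ring).
    specialize (Hmass (1 - 1 / (4 * M2))).
    assert (H4 : 0 < 1 / (4 * M2) <= 1 / 2).
    { split; [apply Rdiv_lt_0_compat; lra|].
      apply Rmult_le_reg_r with (4 * M2); [lra|]. field_simplify; lra. }
    specialize (Hmass ltac:(lra)). rewrite HBz in Hmass.
    replace (M2 * (1 - (1 - 1 / (4 * M2)))) with (1 / 4) in Hmass by (field; lra).
    lra. }
  assert (HY1 : Y < 1) by (apply Rnot_le_lt; intros ?; nra).
  specialize (Hmass Y ltac:(lra)).
  replace (1 - Y ^ 2) with b in Hmass by lra.
  replace (B * (Y / b)) with (M2 * b * Y) in Hmass by (rewrite Hb2'; field; lra).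
  (* [Y + 1 / (1 + Y) <= 3 / 2] on [[0, 1]]. Squaring gives [M2 * B = (M2 * b) ^ 2 >= 1 / 9], the
     source of the 9. *)
  assert (H3 : 1 / 3 <= M2 * b).
  { assert (1 - Y = b / (1 + Y)).
    { apply Rmult_eq_reg_r with (1 + Y); [|lra]. field_simplify; [|lra]. lra. }
    assert (Y + 1 / (1 + Y) <= 3 / 2).
    { apply Rmult_le_reg_r with (1 + Y); [lra|]. field_simplify; [|lra]. nra. }
    replace (M2 * b * Y + M2 * (1 - Y)) with (M2 * b * (Y + 1 / (1 + Y))) in Hmass
      by (rewrite H; field; lra).
    assert (0 <= M2 * b) by nra. nra. }
  rewrite Hb2'. nra.
Qed.

(** * Lower bound for the derivative at the roots *)

Lemma prolate_Derive_reflect (c chi : R) (f : R -> R) (x : R) :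
  prolate c chi f -> -1 < x < 1 -> Derive f (- x) ^ 2 = Derive f x ^ 2.
Proof.
  intros Hf Hx. destruct (prolate_parity _ _ _ Hf) as [s [Hs Hpar]].
  destruct (prolate_ode _ _ _ Hf x Hx) as [H1 _].
  destruct (prolate_ode _ _ _ Hf (- x) ltac:(lra)) as [H2 _].
  assert (E1 : Derive (fun y => f (- y)) x = s * Derive f x).
  { rewrite (Derive_ext _ (fun y => s * f y)) by exact Hpar. apply Derive_scal. }
  assert (E2 : Derive (fun y => f (- y)) x = - Derive f (- x)).
  { apply is_derive_unique. auto_derive; [auto|].
    change (fun z : R => f z) with f. ring. }
  replace (Derive f (- x)) with (- (s * Derive f x)) by lra.
  replace ((- (s * Derive f x)) ^ 2) with (s ^ 2 * Derive f x ^ 2) by ring.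
  rewrite Hs. ring.
Qed.

(* Two lower bounds for [Derive f t ^ 2], namely [energy 0] (amplitude
   monotonicity) and a multiple of [f 1 ^ 2 / (1 - t ^ 2) ^ 2] (energy
   monotonicity), are multiplied, so that [f 1] cancels. *)
Lemma prolate_Derive_nonneg_root (c chi : R) (f : R -> R) (t : R) :
  prolate c chi f -> 0 < chi -> c ^ 2 < chi ->
  RInt (fun x => f x ^ 2) 0 1 = 1 / 2 ->
  0 <= t < 1 -> f t = 0 ->
  1 <= chi /\ exists y, 0 <= y <= 1 /\ 3 * chi * (1 - y) ^ 2 <= 1 /\
    4 * (1 + y) ^ 2 * chi <= 243 * ((1 - t ^ 2) * Derive f t ^ 2) ^ 2.
Proof.
  intros Hf Hchi Hc Hn Ht Hroot.
  destruct (prolate_energy_endpoint c chi f Hf Hchi Hc Hn) as [HM HE].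
  set (z := fun x => (chi - c ^ 2 * x ^ 2) * (1 - x) / (1 + x)).
  assert (HM0 : 0 < Rabs (f 1)).
  { apply Rabs_pos_lt. intros E. rewrite E in HM. lra. }
  (* At a root the deviation from [f 1] is all of [|f 1|]. *)
  assert (Hzt : 1 <= z t).
  { assert (H := prolate_endpoint_deviation c chi f t Hf Hc Ht).
    rewrite Hroot, Rminus_0_r in H. fold (z t) in H. nra. }
  assert (Hqt := potential_pos c chi t Hc ltac:(lra)).
  assert (Hchi1 : 1 <= chi).
  { apply Rle_trans with (1 := Hzt). unfold z.
    apply Rmult_le_reg_r with (1 + t); [lra|].
    unfold Rdiv. rewrite Rmult_assoc, Rinv_l, Rmult_1_r by lra.
    assert (0 <= c ^ 2 * t ^ 2) by nra. nra. }
  split; [assumption|].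
  (* [y] is a point right of [t] with [z y = 1 / 3], so that [|f y| >= 2 / 3 * |f 1|]; the equation
     is multiplied by [1 + x] to avoid division. *)
  destruct (IVT (fun x => (1 + x) - 3 * ((chi - c ^ 2 * x ^ 2) * (1 - x))) t 1)
    as [y [Hy Hzy]]; [| lra | | lra |].
  { intros x. apply continuity_pt_filterlim,
      (ex_derive_continuous (fun x => (1 + x) - 3 * ((chi - c ^ 2 * x ^ 2) * (1 - x)))).
    auto_derive; easy. }
  { assert (z t * (1 + t) = (chi - c ^ 2 * t ^ 2) * (1 - t)) by (unfold z; field; lra).
    nra. }
  assert (Hy1 : y < 1).
  { destruct (Rle_lt_or_eq_dec y 1) as [?|E]; [lra | assumption |].
    rewrite E in Hzy. lra. }
  assert (Hqy := potential_ge c chi y Hc).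
  exists y. split; [lra|]. split.
  { apply Rmult_le_reg_r with (1 + y); [lra|].
    replace (3 * chi * (1 - y) ^ 2 * (1 + y))
      with (3 * (chi * (1 - y ^ 2) * (1 - y))) by ring.
    apply Rle_trans with (3 * ((chi - c ^ 2 * y ^ 2) * (1 - y))); [|lra].
    apply Rmult_le_compat_l; [lra|]. apply Rmult_le_compat_r; lra. }
  assert (Hfy : 4 / 9 * f 1 ^ 2 <= f y ^ 2).
  { assert (H := prolate_endpoint_deviation c chi f y Hf Hc ltac:(lra)).
    replace ((chi - c ^ 2 * y ^ 2) * (1 - y) / (1 + y)) with (1 / 3) in H.
    2: { apply Rmult_eq_reg_r with (1 + y); [|lra]. field_simplify; lra. }
    assert (H' := Rabs_triang_inv (f 1) (f 1 - f y)).
    replace (f 1 - (f 1 - f y)) with (f y) in H' by ring.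
    rewrite <- (pow2_abs (f 1)), <- (pow2_abs (f y)). nra. }
  (* Compares energies at [t] and [y]. By the choice of [y], the coefficient of [f y ^ 2] is
     [(1 + y) ^ 2 / 3], and [4 / 27] is [4 / 9 * 1 / 3]. *)
  assert (HQ : 4 / 27 * (1 + y) ^ 2 * f 1 ^ 2 <= (1 - t ^ 2) ^ 2 * Derive f t ^ 2).
  { assert (H := energy_nonincreasing c chi f t y Hf Hc ltac:(lra) ltac:(lra) Hy1).
    unfold energy, flux in H. rewrite Hroot in H.
    assert (H' := pow2_ge_0 ((1 - y ^ 2) * Derive f y)).
    replace ((1 - y ^ 2) * (chi - c ^ 2 * y ^ 2)) with ((1 + y) ^ 2 / 3) in H by nra.
    assert (0 <= (1 + y) ^ 2) by apply pow2_ge_0. nra. }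
  assert (HA : energy c chi f 0 <= Derive f t ^ 2).
  { assert (H := amplitude_nondecreasing c chi f 0 t Hf Hc ltac:(lra) ltac:(lra) ltac:(lra)).
    assert (E : energy c chi f 0 = chi * amplitude c chi f 0)
      by (unfold energy, amplitude, flux; field; lra).
    rewrite E. unfold amplitude at 2 in H. rewrite Hroot in H.
    assert (Hq := potential_ge c chi t Hc).
    assert (HD := pow2_ge_0 (Derive f t)).
    assert (chi * ((1 - t ^ 2) / (chi - c ^ 2 * t ^ 2)) <= 1).
    { apply Rmult_le_reg_r with (chi - c ^ 2 * t ^ 2); [lra|].
      field_simplify; lra. }
    apply Rle_trans with
      (chi * ((1 - t ^ 2) / (chi - c ^ 2 * t ^ 2)) * Derive f t ^ 2); [|nra].
    rewrite Rmult_assoc. apply Rmult_le_compat_l; lra. }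
  set (D2 := Derive f t ^ 2) in *.
  replace (((1 - t ^ 2) * D2) ^ 2) with ((1 - t ^ 2) ^ 2 * D2 * D2) by ring.
  (* The constant 243 is this 27 times the 9 of [prolate_energy_endpoint]. *)
  assert (H1 : 4 / 27 * (1 + y) ^ 2 * f 1 ^ 2 * energy c chi f 0
    <= (1 - t ^ 2) ^ 2 * D2 * D2).
  { apply Rmult_le_compat; try assumption.
    - apply Rmult_le_pos; [|lra]. assert (0 <= (1 + y) ^ 2) by apply pow2_ge_0. lra.
    - apply Rnot_lt_le; intros ?. nra. }
  assert (0 <= (1 + y) ^ 2) by apply pow2_ge_0.
  assert ((1 + y) ^ 2 * chi <= (1 + y) ^ 2 * (9 * f 1 ^ 2 * energy c chi f 0))
    by (apply Rmult_le_compat_l; assumption).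
  nra.
Qed.

Lemma prolate_Derive_root (c chi : R) (f : R -> R) (t : R) :
  prolate c chi f -> 0 < chi -> c ^ 2 < chi ->
  RInt (fun x => f x ^ 2) 0 1 = 1 / 2 ->
  -1 < t < 1 -> f t = 0 ->
  1 <= chi /\ exists y, 0 <= y <= 1 /\ 3 * chi * (1 - y) ^ 2 <= 1 /\
    4 * (1 + y) ^ 2 * chi <= 243 * ((1 - t ^ 2) * Derive f t ^ 2) ^ 2.
Proof.
  intros Hf Hchi Hc Hn Ht Hroot. destruct (Rle_lt_dec 0 t) as [H0|H0].
  - apply prolate_Derive_nonneg_root with c; lra || assumption.
  - destruct (prolate_parity _ _ _ Hf) as [s [_ Hpar]].
    rewrite <- (prolate_Derive_reflect c chi f t Hf Ht).
    replace (t ^ 2) with ((- t) ^ 2) by ring.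
    apply prolate_Derive_nonneg_root with c; try lra; try assumption.
    rewrite Hpar, Hroot. ring.
Qed.

(** * Weighted supremum bound *)

(* With [k = sqrt chi], [J = (2 + k + chi / k) I + flux f * f / k] satisfies
   [J' >= (2 + k) f ^ 2 + (1 - x ^ 2) f' ^ 2 / k], which dominates the
   derivative of [- (1 - x ^ 2) f ^ 2] by AM-GM. *)
Lemma prolate_weighted_sup_nonneg (c chi : R) (f : R -> R) (x : R) :
  prolate c chi f -> 0 < chi ->
  RInt (fun x => f x ^ 2) 0 1 = 1 / 2 ->
  0 <= x < 1 -> (1 - x ^ 2) * f x ^ 2 <= 1 + sqrt chi.
Proof.
  intros Hf Hchi Hn Hx.
  set (k := sqrt chi).
  assert (Hk : 0 < k) by now apply sqrt_lt_R0.
  assert (Hk2 : k * k = chi) by (apply sqrt_sqrt; lra).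
  set (I := fun y : R => RInt (fun x => f x ^ 2) 0 y).
  assert (HI : forall y, 0 <= y < 1 -> is_derive I y (f y ^ 2)).
  { intros y Hy. apply (is_derive_RInt (fun x => f x ^ 2) I 0 y).
    - assert (Hd : 0 < 1 - y) by lra. exists (mkposreal _ Hd). intros b Hb.
      change (Rabs (b - y) < 1 - y) in Hb. apply Rabs_def2 in Hb.
      apply (RInt_correct (fun x => f x ^ 2)), (ex_RInt_continuous (fun y => f y ^ 2)). intros u Hu.
      apply prolate_sqr_continuous with c chi; [assumption|].
      revert Hu. unfold Rmin, Rmax. destruct (Rle_dec 0 b); lra.
    - apply prolate_sqr_continuous with c chi; [assumption | lra]. }
  set (J := fun y => (2 + 2 * k) * I y + flux f y * f y / k).
  set (dJ := fun y => (2 + 2 * k - (chi - c ^ 2 * y ^ 2) / k) * f y ^ 2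
    + (1 - y ^ 2) * Derive f y ^ 2 / k).
  assert (HJ : forall y, 0 <= y < 1 -> is_derive J y (dJ y)).
  { intros y Hy. assert (Hy' : -1 < y < 1) by lra.
    unfold J.
    replace (dJ y) with ((2 + 2 * k) * f y ^ 2
      + (- ((chi - c ^ 2 * y ^ 2) * f y) * f y + flux f y * Derive f y) / k)
      by (unfold dJ, flux; field; lra).
    apply (is_derive_plus (fun y => (2 + 2 * k) * I y) (fun y => flux f y * f y / k)).
    - apply (is_derive_scal I), HI, Hy.
    - apply is_derive_ext with (fun y => / k * (flux f y * f y));
        [intros u; apply Rmult_comm|].
      unfold Rdiv. rewrite (Rmult_comm _ (/ k)).
      apply (is_derive_scal (fun y => flux f y * f y)).
      apply (is_derive_mult (flux f) f).
      + now apply is_derive_flux.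
      + apply Derive_correct, (prolate_ode _ _ _ Hf); lra.
      + intros; apply Rmult_comm. }
  assert (HdJ : forall y, 0 <= y < 1 ->
    (2 + k) * f y ^ 2 + (1 - y ^ 2) * Derive f y ^ 2 / k <= dJ y).
  { intros y Hy. unfold dJ. apply Rplus_le_compat_r, Rmult_le_compat_r;
      [apply pow2_ge_0|].
    enough ((chi - c ^ 2 * y ^ 2) / k <= k) by lra.
    apply Rmult_le_reg_r with k; [assumption|].
    unfold Rdiv. rewrite Rmult_assoc, Rinv_l by lra.
    assert (0 <= c ^ 2 * y ^ 2) by nra. lra. }
  assert (Hpos : forall y, 0 <= y < 1 -> 0 <= (1 - y ^ 2) * Derive f y ^ 2 / k).
  { intros y Hy. apply Rle_mult_inv_pos; [|assumption].
    apply Rmult_le_pos; [nra | apply pow2_ge_0]. }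
  (* By parity, either [f] or its derivative vanishes at 0. *)
  assert (HJ0 : J 0 = 0).
  { unfold J, I. rewrite RInt_point. change zero with 0.
    enough (flux f 0 * f 0 = 0) as -> by (field; lra).
    destruct (prolate_parity _ _ _ Hf) as [s [Hs Hpar]].
    destruct (Req_dec (f 0) 0) as [->|H0]; [ring|].
    assert (Hs1 : s = 1).
    { specialize (Hpar 0). rewrite Ropp_0 in Hpar.
      apply Rmult_eq_reg_r with (f 0); lra. }
    assert (HD : Derive f 0 = 0).
    { assert (E : Derive f 0 = - Derive f 0); [|lra].
      rewrite <- (Derive_ext (fun y => f (- y)) f 0) at 1
        by (intros u; rewrite Hpar, Hs1; ring).
      destruct (prolate_ode _ _ _ Hf 0 ltac:(lra)) as [H1 _].
      apply is_derive_unique. auto_derive; rewrite Ropp_0; [auto|].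
      change (fun z : R => f z) with f. ring. }
    unfold flux. rewrite HD. ring. }
  assert (HJx : 0 <= J x).
  { rewrite <- HJ0. apply (nondecreasing_of_derive J dJ); [lra| |];
      intros y Hy; [apply HJ; lra|].
    apply Rle_trans with (2 := HdJ y ltac:(lra)).
    assert (0 <= f y ^ 2) by apply pow2_ge_0.
    assert (HdJy := Hpos y ltac:(lra)). nra. }
  destruct (prolate_bounded _ _ _ Hf) as [B HB].
  destruct (prolate_Derive_bounded _ _ _ Hf) as [C HC].
  (* Majorant of [J b + (1 - b ^ 2) * f b ^ 2]: the terms not controlled by the mass carry a factor
     vanishing at 1. *)
  set (g := fun y => 1 + k + (1 - y ^ 2) * (C * B / k + B ^ 2)).
  replace (1 + k) with (g 1) by (unfold g; ring).
  apply le_of_le_near_left with x; [lra| |].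
  { apply (ex_derive_continuous g). unfold g. auto_derive; easy. }
  intros b Hb.
  assert (Hmono : J x + (1 - x ^ 2) * f x ^ 2 <= J b + (1 - b ^ 2) * f b ^ 2).
  { apply (nondecreasing_of_derive (fun y => J y + (1 - y ^ 2) * f y ^ 2)
      (fun y => dJ y + (- 2 * y * f y ^ 2 + (1 - y ^ 2) * (2 * f y * Derive f y))));
      [lra| |]; intros y Hy.
    - apply (is_derive_plus J); [apply HJ; lra|].
      destruct (prolate_ode _ _ _ Hf y ltac:(lra)) as [H1 _].
      auto_derive; [auto|]. change (fun z : R => f z) with f. ring.
    - assert (H := HdJ y ltac:(lra)).
      apply Rle_trans with (2 := Rplus_le_compat_r _ _ _ H).
      (* Completing this square leaves the coefficient [2 - 2 * y + k * y ^ 2] on [f y ^ 2], which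
         is nonnegative. *)
      assert (Hsq : 0 <= (1 - y ^ 2) * (k * f y + Derive f y) ^ 2 / k).
      { apply Rle_mult_inv_pos; [|assumption].
        apply Rmult_le_pos; [nra | apply pow2_ge_0]. }
      replace ((1 - y ^ 2) * (k * f y + Derive f y) ^ 2 / k) with
        ((1 - y ^ 2) * (k * f y ^ 2) + (1 - y ^ 2) * (2 * f y * Derive f y)
         + (1 - y ^ 2) * Derive f y ^ 2 / k) in Hsq by (field; lra).
      assert (0 <= f y ^ 2) by apply pow2_ge_0.
      assert (0 <= k * f y ^ 2) by (apply Rmult_le_pos; lra).
      assert (0 <= (2 - 2 * y) * f y ^ 2) by (apply Rmult_le_pos; lra).
      assert (0 <= y ^ 2 * (k * f y ^ 2)) by (apply Rmult_le_pos; nra).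
      lra. }
  assert (HIb : I b <= 1 / 2).
  { rewrite <- Hn. unfold I.
    rewrite <- (RInt_Chasles _ 0 b 1) by
      (apply prolate_sqr_integrable with c chi; lra || assumption).
    rewrite <- (Rplus_0_r (RInt _ 0 b)) at 1. apply Rplus_le_compat_l.
    apply RInt_ge_0; [lra| |intros; apply pow2_ge_0].
    apply prolate_sqr_integrable with c chi; lra || assumption. }
  assert (HJb : J b <= 1 + k + (1 - b ^ 2) * (C * B / k)).
  { unfold J. apply Rplus_le_compat; [nra|].
    replace ((1 - b ^ 2) * (C * B / k)) with ((1 - b ^ 2) * (C * B) / k) by (field; lra).
    apply Rmult_le_compat_r; [now apply Rlt_le, Rinv_0_lt_compat|].
    unfold flux. rewrite Rmult_assoc. apply Rmult_le_compat_l; [nra|].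
    apply Rle_trans with (1 := Rle_abs _). rewrite Rabs_mult.
    apply Rmult_le_compat; try apply Rabs_pos; [apply HC | apply HB]; lra. }
  assert ((1 - b ^ 2) * f b ^ 2 <= (1 - b ^ 2) * B ^ 2).
  { apply Rmult_le_compat_l; [nra|]. apply pow_maj_Rabs, HB; lra. }
  unfold g. lra.
Qed.

Lemma prolate_weighted_sup (c chi : R) (f : R -> R) (x : R) :
  prolate c chi f -> 0 < chi ->
  RInt (fun x => f x ^ 2) 0 1 = 1 / 2 ->
  -1 < x < 1 -> (1 - x ^ 2) * f x ^ 2 <= 1 + sqrt chi.
Proof.
  intros Hf Hchi Hn Hx. destruct (Rle_lt_dec 0 x) as [H0|H0].
  - apply prolate_weighted_sup_nonneg with c; lra || assumption.
  - destruct (prolate_parity _ _ _ Hf) as [s [Hs Hpar]].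
    replace (f x ^ 2) with (f (- x) ^ 2).
    2: { rewrite Hpar. replace ((s * f x) ^ 2) with (s ^ 2 * f x ^ 2) by ring.
         rewrite Hs; ring. }
    replace (x ^ 2) with ((- x) ^ 2) by ring.
    apply prolate_weighted_sup_nonneg with c; lra || assumption.
Qed.

(** * Sturm comparison *)

(* [sqrt (1 - x ^ 2) * f] solves [v'' + W v = 0] with
   [W = (chi - c ^ 2 x ^ 2) / (1 - x ^ 2) + 1 / (1 - x ^ 2) ^ 2 > c ^ 2];
   [S] is its Wronskian with [sin (c (x - a))]. *)
Lemma prolate_not_pos_on_half_period (c chi : R) (f : R -> R) (a : R) :
  prolate c chi f -> 0 < c -> c ^ 2 < chi ->
  -1 < a -> a + PI / c < 1 ->
  ~ (forall x, a < x < a + PI / c -> 0 < f x).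
Proof.
  intros Hf Hc0 Hc Ha Hb Hpos.
  set (b := a + PI / c) in *.
  assert (Hab : a < b).
  { unfold b. assert (0 < PI / c) by (apply Rdiv_lt_0_compat; [apply PI_RGT_0 | easy]).
    lra. }
  set (w := fun x => sin (c * (x - a))).
  set (dw := fun x => c * cos (c * (x - a))).
  (* [N] is the Wronskian times [sqrt (1 - x ^ 2)], free of square roots, so that [prolate_derive]
     applies to it. *)
  set (N := fun x => (1 - x ^ 2) * f x * dw x - flux f x * w x + x * f x * w x).
  set (S := fun x => N x * / sqrt (1 - x ^ 2)).
  set (dS := fun x => ((1 - x ^ 2) * (chi - c ^ 2) + 1) * (f x * w x)
    / ((1 - x ^ 2) * sqrt (1 - x ^ 2))).
  assert (Hr : forall x, -1 < x < 1 -> 0 < sqrt (1 - x ^ 2))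
    by (intros; apply sqrt_lt_R0; nra).
  assert (HS : forall x, -1 < x < 1 -> is_derive S x (dS x)).
  { intros x Hx. specialize (Hr x Hx).
    assert (Hp : 0 < 1 - x ^ 2) by nra.
    assert (HN : is_derive N x (- x * f x * dw x + x * Derive f x * w x
      + ((chi - c ^ 2 * x ^ 2) - c ^ 2 * (1 - x ^ 2) + 1) * (f x * w x))).
    { unfold N, flux, w, dw. prolate_derive Hf Hx. change (x + - a) with (x - a). field. lra. }
    assert (HR : is_derive (fun y => / sqrt (1 - y ^ 2)) x
      (x / ((1 - x ^ 2) * sqrt (1 - x ^ 2)))).
    { auto_derive; replace (1 + - (x * (x * 1))) with (1 - x ^ 2) by ring;
        [repeat split; lra|].
      assert (E : sqrt (1 - x ^ 2) * sqrt (1 - x ^ 2) = 1 - x ^ 2)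
        by (apply sqrt_sqrt; lra).
      set (r := sqrt (1 - x ^ 2)) in *. rewrite <- E. field.
      lra. }
    replace (dS x) with ((- x * f x * dw x + x * Derive f x * w x
      + ((chi - c ^ 2 * x ^ 2) - c ^ 2 * (1 - x ^ 2) + 1) * (f x * w x))
        * / sqrt (1 - x ^ 2) + N x * (x / ((1 - x ^ 2) * sqrt (1 - x ^ 2)))).
    2: { unfold dS, N, flux. field. lra. }
    apply (is_derive_mult N (fun y => / sqrt (1 - y ^ 2))); [assumption..|].
    intros; apply Rmult_comm. }
  assert (Hend : forall x, a <= x <= b -> 0 <= f x).
  { assert (Hcont : forall x, a <= x <= b -> continuous f x)
      by (intros; apply (prolate_cont _ _ _ Hf); lra).
    assert (Hfb : 0 <= f b).
    { apply le_of_le_near_left with a; [assumption | apply Hcont; lra |].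
      intros x Hx. apply Rlt_le, Hpos, Hx. }
    assert (Hfa : 0 <= f a).
    { rewrite <- (Ropp_involutive a).
      apply (le_of_le_near_left (fun x => f (- x)) (- b)); [lra| |].
      - apply (continuous_comp (fun x => - x) f).
        + apply (continuous_opp (fun x : R => x)), continuous_id.
        + rewrite Ropp_involutive. apply Hcont; lra.
      - intros x Hx. apply Rlt_le, Hpos. lra. }
    intros x Hx. destruct (Req_dec x a) as [->|Hxa]; [assumption|].
    destruct (Req_dec x b) as [->|Hxb]; [assumption|]. apply Rlt_le, Hpos; lra. }
  assert (Eb : c * (b - a) = PI) by (unfold b; field; lra).
  (* At [a] and [b] the sine vanishes and its derivative is [c] and [- c], so [S] goes from a
     nonnegative to a nonpositive value although [dS] is positive in between. *)
  assert (HSa : 0 <= S a).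
  { unfold S. apply Rmult_le_pos; [|apply Rlt_le, Rinv_0_lt_compat, Hr; lra].
    unfold N, w, dw. rewrite Rminus_diag, Rmult_0_r, sin_0, cos_0.
    assert (0 <= f a) by (apply Hend; lra).
    assert (0 <= (1 - a ^ 2) * f a) by (apply Rmult_le_pos; nra). nra. }
  assert (HSb : S b <= 0).
  { unfold S. assert (0 < / sqrt (1 - b ^ 2)) by (apply Rinv_0_lt_compat, Hr; lra).
    enough (N b <= 0) by nra.
    unfold N, w, dw. rewrite Eb, sin_PI, cos_PI.
    assert (0 <= f b) by (apply Hend; lra).
    assert (0 <= (1 - b ^ 2) * f b) by (apply Rmult_le_pos; nra). nra. }
  destruct (MVT_cor2 S dS a b Hab) as [xi [E Hxi]].
  { intros x Hx. apply is_derive_Reals, HS. lra. }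
  assert (0 < dS xi).
  { unfold dS. assert (Hp : 0 < 1 - xi ^ 2) by nra.
    apply Rdiv_lt_0_compat; [|apply Rmult_lt_0_compat; [easy | apply Hr; lra]].
    apply Rmult_lt_0_compat; [nra|].
    apply Rmult_lt_0_compat; [now apply Hpos|].
    unfold w. apply sin_gt_0; nra. }
  nra.
Qed.

(** Without a zero, [f] has one sign by the intermediate value theorem, and the previous lemma
    applies to [f] or [- f]. *)
Lemma prolate_zero_in_half_period (c chi : R) (f : R -> R) (a : R) :
  prolate c chi f -> 0 < c -> c ^ 2 < chi ->
  -1 < a -> a + PI / c < 1 ->
  exists x, a < x < a + PI / c /\ f x = 0.
Proof.
  intros Hf Hc0 Hc Ha Hb. apply NNPP; intros Hno.
  assert (Hnz : forall x, a < x < a + PI / c -> f x <> 0)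
    by (intros x Hx E; apply Hno; now exists x).
  assert (Hpi : 0 < PI / c) by (apply Rdiv_lt_0_compat; [apply PI_RGT_0 | easy]).
  assert (Hsame : forall u v, a < u < a + PI / c -> a < v < a + PI / c ->
    f u < 0 -> 0 < f v -> False).
  { intros u v Hu Hv Hfu Hfv.
    destruct (Rtotal_order u v) as [H|[H|H]]; [|subst; lra|].
    - destruct (Ranalysis5.IVT_interv f u v) as [z [Hz E]]; try easy.
      + intros x Hx. apply continuity_pt_filterlim, (prolate_cont _ _ _ Hf); lra.
      + apply (Hnz z); lra.
    - destruct (Ranalysis5.IVT_interv (fun x => - f x) v u) as [z [Hz E]]; try lra.
      + intros x Hx. apply continuity_pt_filterlim, (continuous_opp f).
        apply (prolate_cont _ _ _ Hf); lra.
      + apply (Hnz z); lra. }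
  set (m := a + PI / c / 2).
  assert (Hm : a < m < a + PI / c) by (unfold m; lra).
  destruct (Rtotal_order (f m) 0) as [H|[H|H]].
  - apply (prolate_not_pos_on_half_period c chi (fun x => - f x) a); try easy.
    + now apply prolate_opp.
    + intros x Hx. assert (H1 := Hnz x Hx). assert (H2 := Hsame m x Hm Hx H).
      destruct (Rtotal_order (f x) 0) as [?|[?|?]]; [lra | easy | tauto].
  - now apply (Hnz m).
  - apply (prolate_not_pos_on_half_period c chi f a); try easy.
    intros x Hx. assert (H1 := Hnz x Hx).
    destruct (Rtotal_order (f x) 0) as [?|[?|?]]; [|easy|easy].
    exfalso. now apply (Hsame x m).
Qed.

Lemma lt_of_increasing_index (t : nat -> R) (n i j : nat) :
  (forall j, (1 <= j < n)%nat -> t j < t (S j)) ->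
  (1 <= i)%nat -> (j <= n)%nat -> (1 <= j)%nat -> (i <= n)%nat ->
  t i < t j -> (i < j)%nat.
Proof.
  intros Hinc Hi Hjn Hj Hin Hlt.
  assert (Hmono : forall d, (j + d <= n)%nat -> t j <= t (j + d)%nat).
  { induction d as [|d IH]; intros Hd; [rewrite Nat.add_0_r; lra|].
    specialize (IH ltac:(lia)). rewrite Nat.add_succ_r.
    specialize (Hinc (j + d)%nat ltac:(lia)). lra. }
  destruct (Nat.lt_ge_cases i j) as [|Hle]; [assumption|].
  specialize (Hmono (i - j)%nat ltac:(lia)).
  replace (j + (i - j))%nat with i in Hmono by lia. lra.
Qed.

(** Otherwise [n + 1] adjacent intervals of length [PI / c], centred at 0, fit inside [(-1, 1)], and
    each contains a root. *)
Lemma bandwidth_le_roots (c chi : R) (f : R -> R) (n : nat) (t : nat -> R) :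
  prolate c chi f -> 0 < c -> c ^ 2 < chi ->
  (forall j, (1 <= j < n)%nat -> t j < t (S j)) ->
  (forall x, -1 < x < 1 -> f x = 0 -> exists j, (1 <= j <= n)%nat /\ x = t j) ->
  c <= PI / 2 * (INR n + 1).
Proof.
  intros Hf Hc0 Hc Hinc Hall. apply Rnot_lt_le; intros Hlt.
  set (h := PI / c).
  assert (Hh : 0 < h) by (apply Rdiv_lt_0_compat; [apply PI_RGT_0 | easy]).
  assert (HL : (INR n + 1) * h < 2).
  { unfold h. apply Rmult_lt_reg_r with c; [assumption|]. field_simplify; lra. }
  set (a := fun i => - ((INR n + 1) * h / 2) + INR i * h).
  assert (Hz : forall i, (i <= n)%nat ->
    exists j, (S i <= j <= n)%nat /\ a i < t j < a (S i)).
  { assert (Hzero : forall i, (i <= n)%nat ->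
      exists j, (1 <= j <= n)%nat /\ a i < t j < a (S i)).
    { intros i Hi. assert (Hi' := le_INR _ _ Hi). assert (Hi0 := pos_INR i).
      assert (E : a (S i) = a i + PI / c) by (unfold a; rewrite S_INR; fold h; ring).
      assert (Ha : -1 < a i) by (unfold a; nra).
      assert (Hb : a i + PI / c < 1) by (rewrite <- E; unfold a; rewrite S_INR; nra).
      destruct (prolate_zero_in_half_period c chi f (a i) Hf Hc0 Hc Ha Hb)
        as [x [Hx Hfx]].
      destruct (Hall x ltac:(lra) Hfx) as [j [Hj ->]].
      exists j. rewrite E. now split. }
    (* The root found in interval [i], counted from 0, has index at least [i + 1]; for [i = n] this
       exceeds the range. *)
    induction i as [|i IH]; intros Hi; [now apply Hzero|].
    destruct (IH ltac:(lia)) as [j [Hj Htj]].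
    destruct (Hzero (S i) Hi) as [j' [Hj' Htj']].
    exists j'. split; [|assumption].
    assert (j < j')%nat by (apply lt_of_increasing_index with t n; lia || lra || easy).
    lia. }
  destruct (Hz n (le_n n)) as [j [Hj _]]. lia.
Qed.

(** The degree 4 Taylor polynomial bounds the cosine from above and is negative at [8 / 5]. *)
Lemma PI_le_16_5 : PI <= 16 / 5.
Proof.
  apply Rnot_lt_le; intros Hlt.
  assert (H0 : 0 <= cos (8 / 5)) by (apply cos_ge_0; lra).
  destruct (pre_cos_bound (8 / 5) 0) as [_ H]; [lra..|].
  unfold cos_approx, cos_term in H. simpl in H. lra.
Qed.

(** * Integral bounds and the theorem *)

Lemma half_mass (f : R -> R) (s : R) :
  s ^ 2 = 1 -> (forall x, f (- x) = s * f x) ->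
  (forall x, -1 <= x <= 1 -> continuous (fun y => f y ^ 2) x) ->
  RInt (fun x => f x ^ 2) (-1) 1 = 1 ->
  RInt (fun x => f x ^ 2) 0 1 = 1 / 2.
Proof.
  intros Hs Hpar Hcont Hn.
  assert (Hi : forall a b, -1 <= a <= b -> b <= 1 -> ex_RInt (fun y => f y ^ 2) a b).
  { intros a b Ha Hb. apply (ex_RInt_continuous (fun y => f y ^ 2)). intros z Hz.
    rewrite Rmin_left, Rmax_right in Hz by lra. apply Hcont; lra. }
  assert (Hev : RInt (fun x => f x ^ 2) (-1) 0 = RInt (fun x => f x ^ 2) 0 1).
  { apply is_RInt_unique.
    assert (H := RInt_correct _ _ _ (Hi 0 1 ltac:(lra) ltac:(lra))).
    rewrite <- (opp_opp (RInt _ 0 1)).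
    apply is_RInt_swap in H.
    replace 1 with (- (-1)) in H at 1 by ring. rewrite <- Ropp_0 in H at 1.
    apply is_RInt_comp_opp in H. apply is_RInt_opp in H.
    rewrite ?Ropp_0 in H. revert H. apply is_RInt_ext. intros x _.
    rewrite opp_opp, Hpar.
    replace ((s * f x) ^ 2) with (s ^ 2 * f x ^ 2) by ring. rewrite Hs. apply Rmult_1_l. }
  rewrite <- (RInt_Chasles _ (-1) 0 1) in Hn by (apply Hi; lra).
  rewrite Hev in Hn. unfold plus in Hn; simpl in Hn. simpl. lra.
Qed.

(* Integrates [f g <= (A ^ 2 + B ^ 2) f ^ 2 + 1 / 4] for
   [g = A cos + B sin], which holds since [g ^ 2 <= A ^ 2 + B ^ 2]. *)
Lemma half_transform_bound (f w : R -> R) :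
  (forall x, 0 <= x <= 1 -> continuous f x) ->
  (forall x, 0 <= x <= 1 -> continuous w x) ->
  RInt (fun x => f x ^ 2) 0 1 = 1 / 2 ->
  RInt (fun x => f x * cos (w x)) 0 1 ^ 2 + RInt (fun x => f x * sin (w x)) 0 1 ^ 2
    <= 1 / 2.
Proof.
  intros Hf Hw Hn.
  set (A := RInt (fun x => f x * cos (w x)) 0 1).
  set (B := RInt (fun x => f x * sin (w x)) 0 1).
  assert (HA : is_RInt (fun x => f x * cos (w x)) 0 1 A).
  { apply (RInt_correct (fun x => f x * cos (w x))).
    apply (ex_RInt_continuous (fun x => f x * cos (w x))). intros z Hz.
    rewrite Rmin_left, Rmax_right in Hz by lra.
    apply (continuous_mult f); [now apply Hf|].
    apply (continuous_comp w cos); [now apply Hw | apply continuous_cos]. }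
  assert (HB : is_RInt (fun x => f x * sin (w x)) 0 1 B).
  { apply (RInt_correct (fun x => f x * sin (w x))).
    apply (ex_RInt_continuous (fun x => f x * sin (w x))). intros z Hz.
    rewrite Rmin_left, Rmax_right in Hz by lra.
    apply (continuous_mult f); [now apply Hf|].
    apply (continuous_comp w sin); [now apply Hw | apply continuous_sin]. }
  assert (HF : is_RInt (fun x => f x ^ 2) 0 1 (1 / 2)).
  { rewrite <- Hn. apply (RInt_correct (fun x => f x ^ 2)).
    apply (ex_RInt_continuous (fun x => f x ^ 2)). intros z Hz.
    rewrite Rmin_left, Rmax_right in Hz by lra.
    apply (continuous_comp f (fun u => u ^ 2)); [now apply Hf|].
    apply (ex_derive_continuous (fun u => u ^ 2)). auto_derive; easy. }
  set (rho := A ^ 2 + B ^ 2).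
  assert (HL := is_RInt_plus _ _ _ _ _ _
    (is_RInt_scal _ _ _ A _ HA) (is_RInt_scal _ _ _ B _ HB)).
  assert (HR := is_RInt_plus _ _ _ _ _ _
    (is_RInt_scal _ _ _ rho _ HF) (is_RInt_const 0 1 (1 / 4))).
  (* The left side is [rho] itself, so [rho <= rho / 2 + 1 / 4], that is [rho <= 1 / 2]. *)
  assert (H : A * A + B * B <= rho * (1 / 2) + (1 - 0) * (1 / 4)).
  { refine (is_RInt_le _ _ 0 1 _ _ _ HL HR _); [lra|].
    intros x _. unfold plus, scal, mult; simpl. unfold mult; simpl.
    assert (Hcs := sin2_cos2 (w x)). unfold Rsqr in Hcs.
    set (u := sin (w x)) in *. set (v := cos (w x)) in *.
    assert (Hg : (A * v + B * u) ^ 2 <= rho).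
    { unfold rho.
      assert (E : A ^ 2 + B ^ 2 = (A ^ 2 + B ^ 2) * (u * u + v * v))
        by (rewrite Hcs; ring).
      rewrite E. assert (0 <= (A * u - B * v) ^ 2) by apply pow2_ge_0. nra. }
    assert (Hf2 : 0 <= f x ^ 2) by apply pow2_ge_0.
    assert (H1 : (A * v + B * u) ^ 2 * f x ^ 2 <= rho * f x ^ 2)
      by (apply Rmult_le_compat_r; assumption).
    assert (0 <= ((A * v + B * u) * f x - 1 / 2) ^ 2) by apply pow2_ge_0.
    nra. }
  unfold rho in *. nra.
Qed.

(** The triangle inequality for complex numbers [x j + i y j], by induction with Cauchy-Schwarz for
    the cross term. *)
Lemma sum_pair_bound (x y : nat -> R) (D : R) (n : nat) :
  0 <= D ->
  (forall j, (1 <= j <= n)%nat -> x j ^ 2 + y j ^ 2 <= D ^ 2) ->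
  sum_n_m x 1 n ^ 2 + sum_n_m y 1 n ^ 2 <= (INR n * D) ^ 2.
Proof.
  intros HD. induction n as [|n IH]; intros H.
  - rewrite !sum_n_m_zero by lia. change zero with 0. simpl. lra.
  - specialize (IH ltac:(intros; apply H; lia)).
    specialize (H (S n) ltac:(lia)).
    rewrite !sum_n_Sm by lia. unfold plus; simpl plus.
    rewrite S_INR. assert (Hn := pos_INR n).
    set (X := sum_n_m x 1 n) in *. set (Y := sum_n_m y 1 n) in *.
    set (u := x (S n)) in *. set (v := y (S n)) in *.
    change ((X + u) ^ 2 + (Y + v) ^ 2 <= ((INR n + 1) * D) ^ 2).
    assert (0 <= INR n * D) by now apply Rmult_le_pos.
    assert (Hcs : X * u + Y * v <= INR n * D * D).
    { apply Rsqr_incr_0_var; [|now apply Rmult_le_pos]. unfold Rsqr.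
      assert (0 <= (X * v - Y * u) ^ 2) by apply pow2_ge_0.
      apply Rle_trans with ((X ^ 2 + Y ^ 2) * (u ^ 2 + v ^ 2)); [nra|].
      replace (INR n * D * D * (INR n * D * D)) with ((INR n * D) ^ 2 * D ^ 2) by ring.
      apply Rmult_le_compat; try assumption; nra. }
    nra.
Qed.

(** * Specialisation to the functions [psi_n] *)

Lemma pswf_prolate (c : R) (lam_re lam_im : nat -> R) (psi : nat -> R -> R)
    (chi : nat -> R) (n : nat) :
  PSWF_system c lam_re lam_im psi chi -> prolate c (chi n) (psi n).
Proof.
  intros H. constructor.
  - apply (pswf_cont _ _ _ _ _ H).
  - apply (pswf_ode _ _ _ _ _ H).
  - exists ((-1) ^ n). split; [|apply (pswf_parity _ _ _ _ _ H)].
    rewrite <- pow_mult, Nat.mul_comm, pow_mult.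
    replace ((-1) ^ 2) with 1 by ring. apply pow1.
Qed.

Lemma pswf_half_mass (c : R) (lam_re lam_im : nat -> R) (psi : nat -> R -> R)
    (chi : nat -> R) (n : nat) :
  PSWF_system c lam_re lam_im psi chi -> RInt (fun x => psi n x ^ 2) 0 1 = 1 / 2.
Proof.
  intros H. assert (Hf := pswf_prolate _ _ _ _ _ n H).
  destruct (prolate_parity _ _ _ Hf) as [s [Hs Hpar]].
  apply half_mass with s; try assumption.
  - intros x Hx. now apply prolate_sqr_continuous with c (chi n).
  - apply (pswf_norm _ _ _ _ _ H).
Qed.

Lemma pswf_chi_le (c : R) (lam_re lam_im : nat -> R) (psi : nat -> R -> R)
    (chi : nat -> R) (m n : nat) :
  PSWF_system c lam_re lam_im psi chi -> (m <= n)%nat -> chi m <= chi n.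
Proof.
  intros H Hmn. induction Hmn as [|n Hmn IH]; [lra|].
  assert (Hi := pswf_chi_incr _ _ _ _ _ H n). lra.
Qed.

(** Here [s] is [sqrt chi_n], and [128 / 1000] is just below [2 / sqrt 243], from the bound at the
    roots. Since [c <= s], the left side is at most [(c + c ^ 2) * s], so [s] can be divided out. *)
Lemma ratio_constant (c s y n : R) :
  0 < c -> c <= s -> 1 <= s -> 1 <= n -> c <= 16 / 5 * n ->
  0 <= y <= 1 -> 3 * s ^ 2 * (1 - y) ^ 2 <= 1 ->
  c ^ 2 * (1 + s) <= 64 * n ^ 2 * (128 / 1000 * (1 + y) * s).
Proof.
  intros Hc Hcs Hs Hn Hcn Hy Hsy.
  assert (Hq : 0 <= s * (1 - y)) by nra.
  assert (Hq3 : s * (1 - y) <= 58 / 100) by nra.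
  assert (Hmain : c + c ^ 2 <= 64 * n ^ 2 * (128 / 1000 * (1 + y))).
  { destruct (Rle_lt_dec c 2) as [H2|H2].
    - assert (42 / 100 <= y) by nra. assert (1 <= n ^ 2) by nra. nra.
    - assert (71 / 100 <= y) by nra.
      assert (c ^ 2 <= 1024 / 100 * n ^ 2) by nra.
      assert (n <= n ^ 2) by nra. nra. }
  apply Rle_trans with ((c + c ^ 2) * s); [nra|].
  replace (64 * n ^ 2 * (128 / 1000 * (1 + y) * s))
    with (64 * n ^ 2 * (128 / 1000 * (1 + y)) * s) by ring.
  apply Rmult_le_compat_r; [lra | assumption].
Qed.

Lemma pswf_ratio_at_root (c : R) (lam_re lam_im : nat -> R) (psi : nat -> R -> R)
    (chi : nat -> R) (n m : nat) (x : R) :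
  0 < c -> PSWF_system c lam_re lam_im psi chi -> (m < n)%nat -> c ^ 2 < chi n ->
  c <= 16 / 5 * INR n ->
  -1 < x < 1 -> psi n x = 0 ->
  (psi m x / Derive (psi n) x) ^ 2 <= 64 * INR n ^ 2 / c ^ 2.
Proof.
  intros Hc Hsys Hmn Hchi Hcn Hx Hroot.
  assert (Hn1 : 1 <= INR n) by (apply (le_INR 1); lia).
  assert (Hpn := pswf_chi_pos _ _ _ _ _ Hsys n).
  assert (Hpm := pswf_chi_pos _ _ _ _ _ Hsys m).
  assert (Hle := pswf_chi_le _ _ _ _ _ m n Hsys ltac:(lia)).
  assert (Hd := pswf_simple _ _ _ _ _ Hsys n x Hx Hroot).
  destruct (prolate_Derive_root c (chi n) (psi n) x (pswf_prolate _ _ _ _ _ n Hsys)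
    Hpn Hchi (pswf_half_mass _ _ _ _ _ n Hsys) Hx Hroot)
    as [Hchi1 [y [Hy [Hy3 HZ]]]].
  assert (HX := prolate_weighted_sup c (chi m) (psi m) x (pswf_prolate _ _ _ _ _ m Hsys)
    Hpm (pswf_half_mass _ _ _ _ _ m Hsys) Hx).
  assert (Hsq := sqrt_le_1_alt _ _ Hle).
  set (s := sqrt (chi n)) in *.
  assert (Hs2 : s ^ 2 = chi n) by (apply pow2_sqrt; lra).
  assert (Hs0 : 0 <= s) by apply sqrt_pos.
  assert (Hs1 : 1 <= s) by nra.
  assert (Hcs : c <= s) by nra.
  rewrite <- Hs2 in Hy3, HZ.
  assert (Hratio := ratio_constant c s y (INR n) Hc Hcs Hs1 Hn1 Hcn Hy Hy3).
  set (d2 := Derive (psi n) x ^ 2) in *.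
  assert (Hd2 : 0 < d2) by (unfold d2; rewrite <- Rsqr_pow2; now apply Rsqr_pos_lt).
  assert (Hp : 0 < 1 - x ^ 2) by nra.
  assert (HZ' : 128 / 1000 * (1 + y) * s <= (1 - x ^ 2) * d2).
  { assert (0 <= (1 - x ^ 2) * d2) by (apply Rmult_le_pos; lra).
    apply Rsqr_incr_0_var; [|assumption]. unfold Rsqr.
    assert (0 <= ((1 + y) * s) ^ 2) by apply pow2_ge_0. nra. }
  replace ((psi m x / Derive (psi n) x) ^ 2) with (psi m x ^ 2 / d2)
    by (unfold d2; field; assumption).
  assert (0 < c ^ 2) by nra.
  (* Clearing denominators pairs the weight [1 - x ^ 2] with [psi m x ^ 2] on the left and with [d2]
     on the right, as in [HX] and [HZ']. *)
  apply Rmult_le_reg_r with (c ^ 2 * ((1 - x ^ 2) * d2)).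
  { apply Rmult_lt_0_compat; [|apply Rmult_lt_0_compat]; assumption. }
  replace (psi m x ^ 2 / d2 * (c ^ 2 * ((1 - x ^ 2) * d2)))
    with (c ^ 2 * ((1 - x ^ 2) * psi m x ^ 2)) by (field; lra).
  replace (64 * INR n ^ 2 / c ^ 2 * (c ^ 2 * ((1 - x ^ 2) * d2)))
    with (64 * INR n ^ 2 * ((1 - x ^ 2) * d2)) by (field; lra).
  apply Rle_trans with (c ^ 2 * (1 + s)).
  - apply Rmult_le_compat_l; lra.
  - apply Rle_trans with (1 := Hratio). apply Rmult_le_compat_l; [nra | assumption].
Qed.

Theorem theorem61 (c : R) (lam_re lam_im : nat -> R) (psi : nat -> R -> R)
    (chi : nat -> R) (n m : nat) (t : nat -> R) :
  0 < c ->
  PSWF_system c lam_re lam_im psi chi ->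
  (m < n)%nat ->
  chi n > c ^ 2 ->
  (forall j, (1 <= j < n)%nat -> t j < t (S j)) ->
  (forall j, (1 <= j <= n)%nat -> -1 < t j < 1 /\ psi n (t j) = 0) ->
  (forall x, -1 < x < 1 -> psi n x = 0 -> exists j, (1 <= j <= n)%nat /\ x = t j) ->
  c * sqrt (P_re c psi n m t ^ 2 + P_im c psi n m t ^ 2) <= sqrt 32 * INR n ^ 2.
Proof.
  intros Hc Hsys Hmn Hchi Hinc Hroots Hall. apply Rgt_lt in Hchi.
  assert (Hn1 : 1 <= INR n) by (apply (le_INR 1); lia).
  assert (Hcn : c <= 16 / 5 * INR n).
  { assert (H := bandwidth_le_roots c (chi n) (psi n) n t
      (pswf_prolate _ _ _ _ _ n Hsys) Hc Hchi Hinc Hall).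
    assert (Hpi := PI_le_16_5). apply Rle_trans with (1 := H).
    apply Rle_trans with (8 / 5 * (INR n + 1)); [|lra].
    apply Rmult_le_compat_r; lra. }
  (* [D] bounds the modulus of each summand: [(8 * n / c) ^ 2 * (1 / 2)] is [D ^ 2]. The sum of [n]
     terms supplies the second factor [n]. *)
  set (D := sqrt 32 * INR n / c).
  assert (H32 := sqrt_lt_R0 32 ltac:(lra)).
  assert (HD : 0 <= D).
  { apply Rle_mult_inv_pos; [|assumption]. apply Rmult_le_pos; lra. }
  assert (Hsum : P_re c psi n m t ^ 2 + P_im c psi n m t ^ 2 <= (INR n * D) ^ 2).
  { unfold P_re, P_im. apply sum_pair_bound; [assumption|]. intros j Hj.
    destruct (Hroots j Hj) as [Htj Hroot].
    assert (Hr := pswf_ratio_at_root c lam_re lam_im psi chi n m (t j)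
      Hc Hsys Hmn Hchi Hcn Htj Hroot).
    assert (Hab := half_transform_bound (psi n) (fun x => c * x * t j)).
    assert (HPsi : Psi1_re c (psi n) (t j) ^ 2 + Psi1_im c (psi n) (t j) ^ 2 <= 1 / 2).
    { unfold Psi1_re, Psi1_im.
      replace ((- RInt (fun x => psi n x * sin (c * x * t j)) 0 1) ^ 2)
        with (RInt (fun x => psi n x * sin (c * x * t j)) 0 1 ^ 2) by ring.
      apply Hab.
      - intros x Hx. apply (pswf_cont _ _ _ _ _ Hsys). lra.
      - intros x _. apply (ex_derive_continuous (fun x => c * x * t j)).
        auto_derive; easy.
      - apply (pswf_half_mass _ _ _ _ _ n Hsys). }
    set (r := psi m (t j) / Derive (psi n) (t j)) in *.
    set (u := Psi1_re c (psi n) (t j)) in *. set (v := Psi1_im c (psi n) (t j)) in *.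
    replace (D ^ 2) with (64 * INR n ^ 2 / c ^ 2 * (1 / 2)).
    2: { unfold D. replace ((sqrt 32 * INR n / c) ^ 2)
           with (sqrt 32 ^ 2 * INR n ^ 2 / c ^ 2) by (field; lra).
         rewrite pow2_sqrt by lra. field. lra. }
    replace ((r * u) ^ 2 + (r * v) ^ 2) with (r ^ 2 * (u ^ 2 + v ^ 2)) by ring.
    apply Rmult_le_compat; try assumption; nra. }
  apply sqrt_le_1_alt in Hsum.
  rewrite sqrt_pow2 in Hsum by (apply Rmult_le_pos; lra).
  apply Rle_trans with (c * (INR n * D)); [apply Rmult_le_compat_l; lra|].
  apply Req_le. unfold D. field. lra.
Qed.
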